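(* Let $(\mathcal{A}_n)_{n\in\mathbb N}$ be a sequence of unital Banach algebras such that $\limsup_{n\to\infty}C_{\mathrm{PI}}(\mathcal{A}_n)<\infty$. Then $\mathrm{Asy}(\mathcal{A}_n)$ is properly infinite.
   Context: Banach algebras are complex and have a contractive product $\|ab\|\le\|a\|\|b\|$; a unital Banach algebra has unit $1$ with $\|1\|=1$. For a sequence $(\mathcal A_n)$ of Banach algebras, $\ell^\infty(\mathcal A_n)$ is the Banach algebra of all bounded sequences $(a_n)$ with $a_n\in\mathcal A_n$, with pointwise operations and the supremum norm; $c_0(\mathcal A_n)$ is the closed two-sided ideal of sequences with $\lim_{n\to\infty}\|a_n\|=0$; and $\mathrm{Asy}(\mathcal A_n)=\ell^\infty(\mathcal A_n)/c_0(\mathcal A_n)$ with the quotient norm. Two idempotents $p,q$ in an algebra $\mathcal A$ are equivalent, $p\sim q$, if there are $a,b\in\mathcal A$ with $p=ab$ and $q=ba$; they are orthogonal if $pq=0=qp$. A unital algebra $\mathcal A$ is properly infinite if there are orthogonal idempotents $p,q\in\mathcal A$ with $p\sim 1$ and $q\sim 1$. For a unital Banach algebra $\mathcal A$, $$C_{\mathrm{PI}}(\mathcal A)=\inf\{\|a\|\|b\|\|c\|\|d\| : a,b,c,d\in\mathcal A,\ ab=1=cd,\ ad=0=cb\},$$ with $\inf\emptyset=+\infty$ (so finitely many of the $\mathcal A_n$ are allowed to have $C_{\mathrm{PI}}(\mathcal A_n)=+\infty$). *)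

(* Defs.v *)
From HB Require Import structures.
From mathcomp Require Import all_boot all_order all_algebra generic_quotient
  ring_quotient.
From mathcomp Require Import complex.
From mathcomp Require Import all_classical all_reals all_analysis.
Set Implicit Arguments.
Unset Strict Implicit.
Unset Printing Implicit Defensive.
Import Order.TTheory GRing.Theory Num.Theory.
Import numFieldNormedType.Exports.
Local Open Scope classical_set_scope.
Local Open Scope quotient_scope.
Local Open Scope ring_scope.

(* HB refuses a join of [algType] and [normedModType] declared after
   [numDomainType], so the product is part of the mixin and the [algType]
   structure is derived from it. Complex Banach algebras have [K := R[i]]. *)
HB.mixin Record isUnitalBanachAlgebra (K : numFieldType) A
    of CompleteNormedModule K A := {
  ba_one : A ;
  ba_mul : A -> A -> A ;
  ba_mulA : associative ba_mul ;
  ba_mul1l : left_id ba_one ba_mul ;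
  ba_mul1r : right_id ba_one ba_mul ;
  ba_mulDl : left_distributive ba_mul +%R ;
  ba_mulDr : right_distributive ba_mul +%R ;
  ba_scaleAl : forall (k : K) (a b : A),
    k *: ba_mul a b = ba_mul (k *: a) b ;
  ba_scaleAr : forall (k : K) (a b : A),
    k *: ba_mul a b = ba_mul a (k *: b) ;
  ba_normM_le : forall a b : A, `|ba_mul a b| <= `|a| * `|b| ;
  ba_norm1 : `|ba_one| = 1
}.

#[short(type="unitalBanachAlgType")]
HB.structure Definition UnitalBanachAlgebra (K : numFieldType) :=
  {A of CompleteNormedModule K A & isUnitalBanachAlgebra K A}.

Section BanachAlgType.
Variables (K : numFieldType) (A : unitalBanachAlgType K).

Fact ba_one_neq0 : (ba_one : A) != 0.
Proof. by rewrite -normr_eq0 ba_norm1 oner_eq0. Qed.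

HB.instance Definition _ := GRing.Zmodule_isNzRing.Build
  (UnitalBanachAlgebra.sort A) (@ba_mulA K A) (@ba_mul1l K A) (@ba_mul1r K A)
  (@ba_mulDl K A) (@ba_mulDr K A) ba_one_neq0.

HB.instance Definition _ := GRing.Lmodule_isLalgebra.Build K
  (UnitalBanachAlgebra.sort A) (@ba_scaleAl K A).

HB.instance Definition _ := GRing.Lalgebra_isAlgebra.Build K
  (UnitalBanachAlgebra.sort A) (@ba_scaleAr K A).

Lemma normM_le (a b : A) : `|a * b| <= `|a| * `|b|.
Proof. exact: ba_normM_le. Qed.

Lemma norm_one : `|1 : A| = 1.
Proof. exact: ba_norm1. Qed.

End BanachAlgType.

(* In a normed module over [R[i]] the norm takes its values in [R[i]];
   [rnorm] reads this nonnegative number in [R]. *)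
Definition rnorm (R : realType) (V : normedModType R[i]) (x : V) : R :=
  complex.Re `|x|.

Section Rnorm.
Variable R : realType.

Lemma rnormE (V : normedModType R[i]) (x : V) :
  `|x| = (rnorm x)%:C%C.
Proof.
rewrite /rnorm; have: 0 <= `|x| := normr_ge0 x.
by case: (`|x|) => a b; rewrite lecE /= => /andP[/eqP -> _].
Qed.

Lemma rnorm_ge0 (V : normedModType R[i]) (x : V) : 0 <= rnorm x.
Proof. by rewrite -ler0c -rnormE normr_ge0. Qed.

Lemma Re_normc_ge0 (k : R[i]) : 0 <= complex.Re `|k|.
Proof. by rewrite normc_def sqrtr_ge0. Qed.

Lemma rnorm0 (V : normedModType R[i]) : rnorm (0 : V) = 0.
Proof. by rewrite /rnorm normr0. Qed.

Lemma rnormB (V : normedModType R[i]) (x y : V) :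
  rnorm (x - y) <= rnorm x + rnorm y.
Proof. by rewrite -lecR rmorphD /= -!rnormE ler_normB. Qed.

Lemma rnormZ (V : normedModType R[i]) (k : R[i]) (x : V) :
  rnorm (k *: x) = complex.Re `|k| * rnorm x.
Proof.
apply: (@complexI R); rewrite rmorphM /= -!rnormE normrZ.
by congr (_ * _).
Qed.

Lemma rnormM (A : unitalBanachAlgType R[i]) (x y : A) :
  rnorm (x * y) <= rnorm x * rnorm y.
Proof. by rewrite -lecR rmorphM /= -!rnormE normM_le. Qed.

Lemma rnorm1 (A : unitalBanachAlgType R[i]) : rnorm (1 : A) = 1.
Proof. by rewrite /rnorm norm_one. Qed.

End Rnorm.

Section ProperlyInfinite.
Variables (K : pzRingType) (A : algType K).

Definition idempotent_elt (p : A) : Prop := p * p = p.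

Definition orthogonal_elts (p q : A) : Prop := p * q = 0 /\ q * p = 0.

Definition equivalent_idem (p q : A) : Prop :=
  exists a b : A, p = a * b /\ q = b * a.

Definition properly_infinite : Prop :=
  exists p q : A,
    [/\ idempotent_elt p, idempotent_elt q, orthogonal_elts p q,
        equivalent_idem p 1 & equivalent_idem q 1].

End ProperlyInfinite.

Definition C_PI (R : realType) (A : unitalBanachAlgType R[i]) : \bar R :=
  ereal_inf [set r : \bar R | exists a b c d : A,
    [/\ a * b = 1, c * d = 1, a * d = 0 & c * b = 0] /\
    r = (rnorm a * rnorm b * rnorm c * rnorm d)%:E].

Section SeqProd.
Variables (K : numFieldType) (A : nat -> unitalBanachAlgType K).

Definition seqprod : Type := forall n, A n.

HB.instance Definition _ := gen_eqMixin seqprod.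
HB.instance Definition _ := gen_choiceMixin seqprod.

Implicit Types a b c : seqprod.

Let seqprod_ext a b : (forall n, a n = b n) -> a = b.
Proof. exact: functional_extensionality_dep. Qed.

Let zero : seqprod := fun=> 0.
Let one : seqprod := fun=> 1.
Let opp a : seqprod := fun n => - a n.
Let add a b : seqprod := fun n => a n + b n.
Let mul a b : seqprod := fun n => a n * b n.
Let scale (k : K) a : seqprod := fun n => k *: a n.

Fact seqprod_addA : associative add.
Proof. by move=> a b c; apply: seqprod_ext => n; apply: addrA. Qed.
Fact seqprod_addC : commutative add.
Proof. by move=> a b; apply: seqprod_ext => n; apply: addrC. Qed.
Fact seqprod_add0 : left_id zero add.
Proof. by move=> a; apply: seqprod_ext => n; apply: add0r. Qed.
Fact seqprod_addN : left_inverse zero opp add.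
Proof. by move=> a; apply: seqprod_ext => n; apply: addNr. Qed.

HB.instance Definition _ := GRing.isZmodule.Build seqprod
  seqprod_addA seqprod_addC seqprod_add0 seqprod_addN.

Fact seqprod_mulA : associative mul.
Proof. by move=> a b c; apply: seqprod_ext => n; apply: mulrA. Qed.
Fact seqprod_mul1l : left_id one mul.
Proof. by move=> a; apply: seqprod_ext => n; apply: mul1r. Qed.
Fact seqprod_mul1r : right_id one mul.
Proof. by move=> a; apply: seqprod_ext => n; apply: mulr1. Qed.
Fact seqprod_mulDl : left_distributive mul +%R.
Proof. by move=> a b c; apply: seqprod_ext => n; apply: mulrDl. Qed.
Fact seqprod_mulDr : right_distributive mul +%R.
Proof. by move=> a b c; apply: seqprod_ext => n; apply: mulrDr. Qed.
Fact seqprod_one_neq0 : one != 0.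
Proof.
apply/eqP => /(congr1 (fun a : seqprod => a 0%N)) e.
by have /eqP := oner_neq0 (A 0%N); apply.
Qed.

HB.instance Definition _ := GRing.Zmodule_isNzRing.Build seqprod
  seqprod_mulA seqprod_mul1l seqprod_mul1r seqprod_mulDl seqprod_mulDr
  seqprod_one_neq0.

Fact seqprod_scaleA k l a : scale k (scale l a) = scale (k * l) a.
Proof. by apply: seqprod_ext => n; apply: scalerA. Qed.
Fact seqprod_scale1 : left_id 1 scale.
Proof. by move=> a; apply: seqprod_ext => n; apply: scale1r. Qed.
Fact seqprod_scaleDr : right_distributive scale +%R.
Proof. by move=> k a b; apply: seqprod_ext => n; apply: scalerDr. Qed.
Fact seqprod_scaleDl a : {morph scale^~ a : k l / k + l}.
Proof. by move=> k l; apply: seqprod_ext => n; apply: scalerDl. Qed.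

HB.instance Definition _ := GRing.Zmodule_isLmodule.Build K seqprod
  seqprod_scaleA seqprod_scale1 seqprod_scaleDr seqprod_scaleDl.

Fact seqprod_scaleAl k a b : k *: (a * b) = (k *: a) * b.
Proof. by apply: seqprod_ext => n; apply: scalerAl. Qed.
HB.instance Definition _ := GRing.Lmodule_isLalgebra.Build K seqprod
  seqprod_scaleAl.

Fact seqprod_scaleAr k a b : k *: (a * b) = a * (k *: b).
Proof. by apply: seqprod_ext => n; apply: scalerAr. Qed.
HB.instance Definition _ := GRing.Lalgebra_isAlgebra.Build K seqprod
  seqprod_scaleAr.

End SeqProd.

Section Asy.
Variables (R : realType) (A : nat -> unitalBanachAlgType R[i]).

Definition bounded_seq : {pred seqprod A} :=
  [pred a : seqprod A | `[< exists M : R, forall n, rnorm (a n) <= M >]].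

Lemma bounded_seqP (a : seqprod A) :
  reflect (exists M : R, forall n, rnorm (a n) <= M) (a \in bounded_seq).
Proof. exact: asboolP. Qed.

Fact bounded_seq_subalg : subalg_closed bounded_seq.
Proof.
split=> [|k a b|a b].
- by apply/bounded_seqP; exists 1 => n; rewrite rnorm1.
- move=> /bounded_seqP[M aM] /bounded_seqP[N bN]; apply/bounded_seqP.
  exists (complex.Re `|k| * M + N) => n.
  have -> : (k *: a + b) n = k *: a n - (0 - b n) by rewrite sub0r opprK.
  apply: (le_trans (rnormB _ _)); apply: lerD.
    by rewrite rnormZ ler_wpM2l// Re_normc_ge0.
  by apply: (le_trans (rnormB _ _)); rewrite rnorm0 add0r.
- move=> /bounded_seqP[M aM] /bounded_seqP[N bN]; apply/bounded_seqP.
  exists (M * N) => n; apply: (le_trans (rnormM _ _)).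
  by apply: ler_pM; rewrite ?rnorm_ge0.
Qed.

HB.instance Definition _ :=
  GRing.isSubalgClosed.Build _ _ bounded_seq bounded_seq_subalg.

Record linfty := Linfty {
  linfty_val : seqprod A ;
  linfty_bounded : linfty_val \in bounded_seq }.

HB.instance Definition _ := [isSub for linfty_val].
HB.instance Definition _ := [Choice of linfty by <:].
HB.instance Definition _ := [SubChoice_isSubAlgebra of linfty by <:].

Definition c0 : {pred linfty} :=
  [pred a : linfty | `[< (fun n => rnorm (val a n)) @ \oo --> (0 : R) >]].

Lemma c0P (a : linfty) :
  reflect ((fun n => rnorm (val a n)) @ \oo --> (0 : R)) (a \in c0).
Proof. exact: asboolP. Qed.

Fact c0_zmod : zmod_closed c0.
Proof.
split=> [|a b /c0P a0 /c0P b0]; apply/c0P.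
  have -> : (fun n => rnorm (val (0 : linfty) n)) = (fun=> 0).
    by apply/funext => n; rewrite -[RHS](rnorm0 (A n)).
  exact: cvg_cst.
have h : (fun n => rnorm (val a n) + rnorm (val b n)) @ \oo --> (0 : R).
  by rewrite -[0 in X in _ --> X]addr0; apply: cvgD.
apply: (squeeze_cvgr _ (cvg_cst 0) h).
by near=> n; rewrite rnorm_ge0 /=; apply: rnormB.
Unshelve. all: by end_near. Qed.

HB.instance Definition _ := GRing.isZmodClosed.Build linfty c0 c0_zmod.

Lemma c0_mull (a b : linfty) : b \in c0 -> a * b \in c0.
Proof.
move=> /c0P b0; apply/c0P.
have /bounded_seqP[M aM] := linfty_bounded a.
have h : (fun n => M * rnorm (val b n)) @ \oo --> (0 : R).
  by rewrite -(mulr0 M); apply: cvgM => //; apply: cvg_cst.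
apply: (squeeze_cvgr _ (cvg_cst 0) h).
near=> n; rewrite rnorm_ge0 /=; apply: (le_trans (rnormM _ _)).
by apply: ler_wpM2r; rewrite ?rnorm_ge0.
Unshelve. all: by end_near. Qed.

Lemma c0_mulr (a b : linfty) : a \in c0 -> a * b \in c0.
Proof.
move=> /c0P a0; apply/c0P.
have /bounded_seqP[M bM] := linfty_bounded b.
have h : (fun n => rnorm (val a n) * M) @ \oo --> (0 : R).
  by rewrite -(mul0r M); apply: cvgM => //; apply: cvg_cst.
apply: (squeeze_cvgr _ (cvg_cst 0) h).
near=> n; rewrite rnorm_ge0 /=; apply: (le_trans (rnormM _ _)).
by apply: ler_wpM2l; rewrite ?rnorm_ge0.
Unshelve. all: by end_near. Qed.

Lemma c0_scale (k : R[i]) (a : linfty) : a \in c0 -> k *: a \in c0.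
Proof. by move=> a0; rewrite -mulr_algl c0_mull. Qed.

Lemma c0_one : (1 : linfty) \notin c0.
Proof.
apply/negP => /c0P.
have -> : (fun n => rnorm (val (1 : linfty) n)) = (fun=> 1).
  by apply/funext => n; rewrite -[RHS](rnorm1 (A n)).
move=> h; have /eqP := oner_neq0 R; apply.
by apply: (cvg_unique _ _ h) => //; apply: cvg_cst.
Qed.

(* Only the algebra structure of [asy] is set up: proper infiniteness does not
   involve the quotient norm. *)
Definition asy : Type := Quotient.quot c0.

HB.instance Definition _ := GRing.Zmodule.on asy.
HB.instance Definition _ := EqQuotient.copy asy (Quotient.quot c0).

Definition asy_pi (a : linfty) : asy := \pi_asy a.

Lemma asy_piE a b : asy_pi a = asy_pi b <-> a - b \in c0.
Proof.
rewrite /asy_pi; split=> [/eqP|h]; first by rewrite piE.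
by apply/eqP; rewrite piE.
Qed.

Lemma asy_piD a b : asy_pi a + asy_pi b = asy_pi (a + b).
Proof. exact: esym (raddfD \pi_(Quotient.quot c0) a b). Qed.

Let one : asy := asy_pi 1.
Let mul (x y : asy) : asy := asy_pi (repr x * repr y).
Let scale (k : R[i]) (x : asy) : asy := asy_pi (k *: repr x).

Lemma asy_piM a b : mul (asy_pi a) (asy_pi b) = asy_pi (a * b).
Proof.
apply/asy_piE; rewrite -[X in X - _](subrK (a * repr (asy_pi b))) -mulrBl.
rewrite -addrA -mulrBr rpredD//.
  by apply: c0_mulr; apply/asy_piE; rewrite /asy_pi reprK.
by apply: c0_mull; apply/asy_piE; rewrite /asy_pi reprK.
Qed.

Lemma asy_piZ k a : scale k (asy_pi a) = asy_pi (k *: a).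
Proof.
apply/asy_piE; rewrite -scalerBr; apply: c0_scale.
by apply/asy_piE; rewrite /asy_pi reprK.
Qed.

Lemma asy_ind (P : asy -> Prop) : (forall a, P (asy_pi a)) -> forall x, P x.
Proof. by move=> h x; rewrite -[x]reprK. Qed.

Fact asy_mulA : associative mul.
Proof.
elim/asy_ind => a; elim/asy_ind => b; elim/asy_ind => c.
by rewrite !asy_piM mulrA.
Qed.
Fact asy_mul1l : left_id one mul.
Proof. by elim/asy_ind => a; rewrite asy_piM mul1r. Qed.
Fact asy_mul1r : right_id one mul.
Proof. by elim/asy_ind => a; rewrite asy_piM mulr1. Qed.
Fact asy_mulDl : left_distributive mul +%R.
Proof.
elim/asy_ind => a; elim/asy_ind => b; elim/asy_ind => c.
by rewrite asy_piD !asy_piM asy_piD mulrDl.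
Qed.
Fact asy_mulDr : right_distributive mul +%R.
Proof.
elim/asy_ind => a; elim/asy_ind => b; elim/asy_ind => c.
by rewrite asy_piD !asy_piM asy_piD mulrDr.
Qed.
Fact asy_one_neq0 : one != 0.
Proof.
have <- : asy_pi 0 = 0 by exact: (raddf0 \pi_(Quotient.quot c0)).
apply/eqP => /asy_piE.
by rewrite subr0; apply/negP; apply: c0_one.
Qed.

HB.instance Definition _ := GRing.Zmodule_isNzRing.Build asy
  asy_mulA asy_mul1l asy_mul1r asy_mulDl asy_mulDr asy_one_neq0.

Fact asy_scaleA k l x : scale k (scale l x) = scale (k * l) x.
Proof. by elim/asy_ind: x => a; rewrite !asy_piZ scalerA. Qed.
Fact asy_scale1 : left_id 1 scale.
Proof. by elim/asy_ind => a; rewrite asy_piZ scale1r. Qed.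
Fact asy_scaleDr : right_distributive scale +%R.
Proof.
move=> k; elim/asy_ind => a; elim/asy_ind => b.
by rewrite asy_piD !asy_piZ asy_piD scalerDr.
Qed.
Fact asy_scaleDl x : {morph scale^~ x : k l / k + l}.
Proof.
by elim/asy_ind: x => a k l; rewrite !asy_piZ asy_piD scalerDl.
Qed.

HB.instance Definition _ := GRing.Zmodule_isLmodule.Build R[i] asy
  asy_scaleA asy_scale1 asy_scaleDr asy_scaleDl.

Fact asy_scaleAl k (x y : asy) : k *: (x * y) = (k *: x) * y.
Proof.
elim/asy_ind: x => a; elim/asy_ind: y => b.
rewrite -[LHS]/(scale k (mul _ _)) -[RHS]/(mul (scale _ _) _).
by rewrite asy_piZ !asy_piM asy_piZ scalerAl.
Qed.
HB.instance Definition _ := GRing.Lmodule_isLalgebra.Build R[i] asy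
  asy_scaleAl.

Fact asy_scaleAr k (x y : asy) : k *: (x * y) = x * (k *: y).
Proof.
elim/asy_ind: x => a; elim/asy_ind: y => b.
rewrite -[LHS]/(scale k (mul _ _)) -[RHS]/(mul _ (scale _ _)).
by rewrite asy_piZ !asy_piM asy_piZ scalerAr.
Qed.
HB.instance Definition _ := GRing.Lalgebra_isAlgebra.Build R[i] asy
  asy_scaleAr.

Fact asy_pi_zmod : zmod_morphism asy_pi.
Proof. exact: (raddfB \pi_(Quotient.quot c0)). Qed.
HB.instance Definition _ :=
  GRing.isZmodMorphism.Build linfty asy asy_pi asy_pi_zmod.

Fact asy_pi_monoid : monoid_morphism asy_pi.
Proof. by split=> // a b; rewrite -asy_piM. Qed.
HB.instance Definition _ :=
  GRing.isMonoidMorphism.Build linfty asy asy_pi asy_pi_monoid.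

Fact asy_pi_scalable : scalable asy_pi.
Proof. by move=> k a; rewrite -asy_piZ. Qed.
HB.instance Definition _ :=
  GRing.isScalable.Build R[i] linfty asy *:%R asy_pi asy_pi_scalable.

End Asy.

(* Main.v *)
(** Rescaling [(a, b)] to [(a / |a|, |a| b)] keeps all the defining relations, so
    if [C_PI (A n) < M] the witnesses in [A n] can be taken with norms at most
    [M]: indeed [|a||b|] and [|c||d|] are at least [1] and their product is below
    [M]. For almost all [n] this happens with one and the same [M], so the
    witnesses assemble into bounded sequences [a, b, c, d] satisfying the
    relations modulo [c0], and [ba], [dc] are the required idempotents of the
    quotient. *)
Require Import Defs.
From mathcomp Require Import all_boot all_order all_algebra complex.
From mathcomp Require Import all_classical all_reals all_analysis.

Set Implicit Arguments.
Unset Strict Implicit.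
Unset Printing Implicit Defensive.
Import Order.TTheory GRing.Theory Num.Theory.
Import numFieldNormedType.Exports.
Local Open Scope classical_set_scope.
Local Open Scope ring_scope.

Definition pi_relations (B : nzRingType) (a b c d : B) : Prop :=
  [/\ a * b = 1, c * d = 1, a * d = 0 & c * b = 0].

(** The products of [b * a] and [d * c] have [a * d] or [c * b] in the middle, hence vanish. *)
Lemma pi_relations_properly_infinite (K : pzRingType) (B : algType K)
    (a b c d : B) :
  pi_relations a b c d -> properly_infinite B.
Proof.
move=> [ab cd ad cb]; exists (b * a), (d * c); split.
- by rewrite /idempotent_elt mulrA -[_ * b]mulrA ab mulr1.
- by rewrite /idempotent_elt mulrA -[_ * d]mulrA cd mulr1.
- by split; rewrite mulrA -[X in X * _]mulrA ?ad ?cb mulr0 mul0r.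
- by exists b, a.
- by exists d, c.
Qed.

Section BoundedWitnesses.
Variables (R : realType) (B : unitalBanachAlgType R[i]).
Implicit Types a b c d : B.

Lemma rnormM_ge1 a b : a * b = 1 -> 1 <= rnorm a * rnorm b.
Proof. by move=> ab; rewrite -(rnorm1 B) -ab rnormM. Qed.

(** Take [s] to be the inverse of [rnorm a], seen in [R[i]]; it exists because [rnorm a * rnorm b]
    is at least 1. *)
Lemma normalize_left_factor a b : a * b = 1 ->
  exists2 s : R[i], s != 0 &
    rnorm (s *: a) = 1 /\ rnorm (s^-1 *: b) = rnorm a * rnorm b.
Proof.
move=> /rnormM_ge1 ab1.
have a0 : 0 < rnorm a.
  rewrite lt_neqAle rnorm_ge0 andbT eq_sym; apply: contraTneq ab1 => ->.
  by rewrite mul0r ler10.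
have a0C : (rnorm a)%:C%C != 0 :> R[i] by rewrite fmorph_eq0 gt_eqF.
exists ((rnorm a)%:C%C)^-1; first by rewrite invr_eq0.
rewrite invrK -fmorphV !rnormZ !normc_def /= !expr0n !addr0 !sqrtr_sqr.
by rewrite !ger0_norm ?invr_ge0 ?rnorm_ge0 ?mulVf ?gt_eqF.
Qed.

Lemma C_PI_lt_bounded_relations (M : R) : (C_PI B < M%:E)%E ->
  exists a b c d, pi_relations a b c d /\
    [/\ rnorm a <= M, rnorm b <= M, rnorm c <= M & rnorm d <= M].
Proof.
move=> /ereal_inf_lt[_ [a [b [c [d [[ab cd ad cb] ->]]]]]].
rewrite lte_fin -mulrA => /ltW abcdM.
have ab1 := rnormM_ge1 ab; have cd1 := rnormM_ge1 cd.
have abM : rnorm a * rnorm b <= M.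
  by apply: le_trans abcdM; rewrite ler_peMr ?mulr_ge0 ?rnorm_ge0.
have cdM : rnorm c * rnorm d <= M.
  by apply: le_trans abcdM; rewrite ler_peMl ?mulr_ge0 ?rnorm_ge0.
(* The rescaled left factors have norm 1, so bounding them takes [1 <= M]. *)
have M1 := le_trans ab1 abM.
have [s s0 [sa sb]] := normalize_left_factor ab.
have [t t0 [tc td]] := normalize_left_factor cd.
exists (s *: a), (s^-1 *: b), (t *: c), (t^-1 *: d).
split; last by rewrite sa sb tc td.
split; rewrite -scalerAl -scalerAr ?ab ?cd ?ad ?cb ?scaler0//.
  by rewrite scalerA mulfV ?scale1r.
by rewrite scalerA mulfV ?scale1r.
Qed.

(** Makes the choice of witnesses total in [n]: zeros serve where [C_PI] is not below [M]. There [M]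
    may be negative, hence the bound [|M|]. *)
Lemma conditional_bounded_relations (M : R) : exists w : B * B * B * B,
  [/\ rnorm w.1.1.1 <= `|M|, rnorm w.1.1.2 <= `|M|, rnorm w.1.2 <= `|M|
    & rnorm w.2 <= `|M|] /\
  ((C_PI B < M%:E)%E -> pi_relations w.1.1.1 w.1.1.2 w.1.2 w.2).
Proof.
have [/C_PI_lt_bounded_relations[a [b [c [d [rel [aM bM cM dM]]]]]]|CM] :=
    boolP (C_PI B < M%:E)%E.
  exists (a, b, c, d); split=> //=.
  by split; apply: le_trans (ler_norm M).
by exists (0, 0, 0, 0); split=> //=; rewrite rnorm0.
Qed.

End BoundedWitnesses.

(** The limsup is an infimum of suprema over sets [V] in the filter [\oo], so one of these suprema
    is below [+oo]. *)
Lemma limn_esup_lty_near (R : realType) (u : (\bar R)^nat) :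
  (limn_esup u < +oo)%E -> exists M : R, \forall n \near \oo, (u n < M%:E)%E.
Proof.
move=> /ereal_inf_lt[_ [V Voo <-] supV].
have [M VM] : exists M : R, (ereal_sup (u @` V) < M%:E)%E.
  (* Adding 1 makes the bound strict; a supremum [-oo] lies below 0. *)
  case: (ereal_sup (u @` V)) supV => [r _| |_] //.
    by exists (r + 1); rewrite lte_fin ltrDl.
  by exists 0; rewrite ltNyr.
exists M; apply: filterS Voo => n Vn; apply: le_lt_trans VM.
by apply: ereal_sup_ubound; exists n.
Qed.

(** The difference is eventually zero, hence in [c0]; finitely many bad indices are thus
    harmless. *)
Lemma asy_pi_near (R : realType) (A : nat -> unitalBanachAlgType R[i])
    (x y : linfty A) :
  (\forall n \near \oo, val x n = val y n) -> asy_pi x = asy_pi y.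
Proof.
move=> xy; apply/asy_piE/c0P.
have xy0 : \forall n \near \oo, rnorm (val (x - y) n) = 0.
  apply: filterS xy => n xyn.
  have -> : val (x - y) n = val x n - val y n by [].
  by rewrite xyn subrr rnorm0.
exact: cvg_near_cst xy0.
Qed.

Theorem proposition4p17 (R : realType) (A : nat -> unitalBanachAlgType R[i]) :
  (limn_esup (fun n => C_PI (A n)) < +oo)%E -> properly_infinite (asy A).
Proof.
move=> /limn_esup_lty_near[M CM].
pose w n := projT1 (cid (conditional_bounded_relations (A n) M)).
have wP n := projT2 (cid (conditional_bounded_relations (A n) M)).
have bounded (x : Defs.seqprod A) :
    (forall n, rnorm (x n) <= `|M|) -> x \in @bounded_seq R A.
  by move=> xM; apply/bounded_seqP; exists `|M|.
have aM : (fun n => (w n).1.1.1) \in @bounded_seq R A.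
  by apply: bounded => n; have [[]] := wP n.
have bM : (fun n => (w n).1.1.2) \in @bounded_seq R A.
  by apply: bounded => n; have [[]] := wP n.
have cM : (fun n => (w n).1.2) \in @bounded_seq R A.
  by apply: bounded => n; have [[]] := wP n.
have dM : (fun n => (w n).2) \in @bounded_seq R A.
  by apply: bounded => n; have [[]] := wP n.
apply: (@pi_relations_properly_infinite _ _ (asy_pi (Linfty aM))
  (asy_pi (Linfty bM)) (asy_pi (Linfty cM)) (asy_pi (Linfty dM))).
(* Since [asy_pi] is a ring morphism, each relation in the quotient compares images of two sequences
   that agree wherever [C_PI (A n) < M]. *)
split; rewrite -rmorphM -1?(rmorph1 (@asy_pi R A)) -1?(rmorph0 (@asy_pi R A));
  apply: asy_pi_near; apply: filterS CM => n /(proj2 (wP n))[ab cd ad cb].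
- exact: ab.
- exact: cd.
- exact: ad.
- exact: cb.
Qed.
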